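(* Let $V$ be a vector space over a field $k$ and let $\varphi,\psi\in\mathrm{End}_k(V)$ be two finite potent endomorphisms. Then $\varphi\leq^{GD1}\psi$ if and only if both of the following hold: (I) $\varphi|_{W_\varphi}=\psi|_{W_\varphi}$; (II) $\varphi\leq^{-}\psi$.
   Context: $k$ is an arbitrary field, $V$ an arbitrary (possibly infinite-dimensional) $k$-vector space. An endomorphism $\varphi\in\mathrm{End}_k(V)$ is finite potent if $\varphi^n(V)$ is finite dimensional for some $n\ge 1$. For such $\varphi$ there is a unique $\varphi$-invariant decomposition $V=W_\varphi\oplus U_\varphi$ (the AST decomposition) with $W_\varphi$ finite dimensional, $\varphi|_{W_\varphi}$ an automorphism of $W_\varphi$, and $\varphi|_{U_\varphi}$ nilpotent; the index $m=i(\varphi)$ is the nilpotency order of $\varphi|_{U_\varphi}$ ($i(\varphi)=0$ iff $V$ is finite dimensional and $\varphi$ is an automorphism). A $\{1\}$-inverse of $\varphi$ is $\varphi^-\in\mathrm{End}_k(V)$ with $\varphi\varphi^-\varphi=\varphi$; the set of them is $X_\varphi(1)$, and $X_\varphi^{fp}(1)$ is the subset of those that are finite potent. A G-Drazin inverse of $\varphi$ is $\varphi^{GD}\in\mathrm{End}_k(V)$ with $\varphi\varphi^{GD}\varphi=\varphi$ and $\varphi^{GD}\varphi^m=\varphi^m\varphi^{GD}$; the set of them is $X_\varphi(GD)$. $X_\varphi(GD1)$ is the set of GD1 inverses of $\varphi$: those $\chi\in\mathrm{End}_k(V)$ such that $\chi\varphi\chi=\chi$, $\chi\varphi=\varphi^{GD}\varphi$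 and $\varphi\chi=\varphi\varphi^-$ for some $\varphi^-\in X_\varphi(1)$, $\varphi^{GD}\in X_\varphi(GD)$. For finite potent $\varphi,\psi$: $\varphi\leq^{GD1}\psi$ means that there are $\hat\varphi^{GD1},\tilde\varphi^{GD1}\in X_\varphi(GD1)$ with $\varphi\hat\varphi^{GD1}=\psi\hat\varphi^{GD1}$ and $\tilde\varphi^{GD1}\varphi=\tilde\varphi^{GD1}\psi$. The minus partial order $\varphi\leq^-\psi$ means $X_\psi^{fp}(1)\subseteq X_\varphi^{fp}(1)$. *)

(* Defs.v *)
From HB Require Import structures.
From mathcomp Require Import all_boot all_algebra.
From mathcomp Require Import boolp classical_sets functions.

Set Implicit Arguments.
Unset Strict Implicit.
Unset Printing Implicit Defensive.

Import GRing.Theory.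
Local Open Scope classical_set_scope.
Local Open Scope ring_scope.

Section Definitions.
Variables (k : fieldType) (V : lmodType k).
Implicit Types (A W U : set V) (phi psi chi : {linear V -> V}).

Definition lspan (s : seq V) : set V :=
  [set v | exists c : 'I_(size s) -> k, v = \sum_i c i *: s`_i].

Definition finite_dim A : Prop := exists s : seq V, A = lspan s.

Definition finite_potent phi : Prop :=
  exists2 n, (0 < n)%N & finite_dim (range (iter n phi)).

Definition nilpotent_on phi U : Prop :=
  exists n, forall u, U u -> iter n phi u = 0.

Definition direct_sum W U : Prop :=
  (forall v, exists2 w, W w & exists2 u, U u & v = w + u) /\
  W `&` U = [set 0].

(* [set_bij W W phi] includes the stability of W under phi. *)
Record is_AST phi (D : set V * set V) : Prop := IsAST {
  AST_submodW : submod_closed [in D.1];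
  AST_submodU : submod_closed [in D.2];
  AST_direct : direct_sum D.1 D.2;
  AST_finW : finite_dim D.1;
  AST_autW : set_bij D.1 D.1 phi;
  AST_stableU : phi @` D.2 `<=` D.2;
  AST_nilU : nilpotent_on phi D.2
}.

(* By [ASTP] and [is_AST_unique] below, the default value of [xget] is never
   used when phi is finite potent, and the decomposition does not depend on
   the choice. *)
Definition AST phi : set V * set V := xget (set0, set0) (is_AST phi).

Definition AST_W phi : set V := (AST phi).1.

Definition AST_U phi : set V := (AST phi).2.

(* Order 0 is allowed: iter 0 phi = id, which vanishes on U iff U = 0. *)
Definition is_nilpotency_order phi U (m : nat) : Prop :=
  (forall u, U u -> iter m phi u = 0) /\
  (forall n, (forall u, U u -> iter n phi u = 0) -> (m <= n)%N).

Definition fp_index phi : nat := xget 0%N (is_nilpotency_order phi (AST_U phi)).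

Definition X1 phi : set {linear V -> V} :=
  [set chi : {linear V -> V} | phi \o chi \o phi =1 phi].

Definition X1fp phi : set {linear V -> V} := X1 phi `&` finite_potent.

Definition XGD phi : set {linear V -> V} :=
  [set chi : {linear V -> V} | phi \o chi \o phi =1 phi /\
    chi \o iter (fp_index phi) phi =1 iter (fp_index phi) phi \o chi].

Definition XGD1 phi : set {linear V -> V} :=
  [set chi : {linear V -> V} | chi \o phi \o chi =1 chi /\
    exists (phi1 phiGD : {linear V -> V}),
      [/\ X1 phi phi1, XGD phi phiGD,
          chi \o phi =1 phiGD \o phi & phi \o chi =1 phi \o phi1]].

Definition leGD1 phi psi : Prop :=
  exists (chi chi' : {linear V -> V}),
    [/\ XGD1 phi chi, XGD1 phi chi',
        phi \o chi =1 psi \o chi & chi' \o phi =1 chi' \o psi].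

Definition le_minus phi psi : Prop := X1fp psi `<=` X1fp phi.

End Definitions.

Section WellDefined.
Variables (k : fieldType) (V : lmodType k).
Implicit Types (A W U : set V) (phi psi chi : {linear V -> V}) (p q : {poly k}).

Lemma iter_linear phi n : linear (iter n phi).
Proof. by elim: n => // n IHn a u v; rewrite !iterS IHn linearP. Qed.

(* Evaluation of a polynomial at phi: finite potent endomorphisms are killed by
   a nonzero polynomial, and the AST decomposition is the splitting of V along
   its coprime factors 'X^M and g. *)
Definition pev phi p (v : V) : V := \sum_(i < size p) p`_i *: iter i phi v.

Lemma iterN_linear phi n : exists f : {linear V -> V}, iter n phi =1 f.
Proof.
pose f := GRing.isLinear.Build k V V *:%R (iter n phi) (iter_linear phi n).
pose F : {linear V -> V} := HB.pack (iter n phi) f.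
by exists F.
Qed.

Lemma iterZD phi n a u v :
  iter n phi (a *: u + v) = a *: iter n phi u + iter n phi v.
Proof. exact: iter_linear. Qed.

Lemma iter0 phi n : iter n phi 0 = 0.
Proof. by have [f fE] := iterN_linear phi n; rewrite fE linear0. Qed.

Lemma iterD phi n u v : iter n phi (u + v) = iter n phi u + iter n phi v.
Proof. by have [f fE] := iterN_linear phi n; rewrite !fE linearD. Qed.

Lemma iterZ phi n a v : iter n phi (a *: v) = a *: iter n phi v.
Proof. by have [f fE] := iterN_linear phi n; rewrite !fE linearZ. Qed.

Lemma iter_sum phi n I (r : seq I) (F : I -> V) :
  iter n phi (\sum_(i <- r) F i) = \sum_(i <- r) iter n phi (F i).
Proof.
have [f fE] := iterN_linear phi n; rewrite fE linear_sum.
by apply: eq_bigr => i _; rewrite fE.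
Qed.

Lemma pev_widen phi p v n : (size p <= n)%N ->
  pev phi p v = \sum_(i < n) p`_i *: iter i phi v.
Proof.
move=> le_pn; rewrite /pev (big_ord_widen n (fun i => p`_i *: iter i phi v)) //.
rewrite big_mkcond; apply: eq_bigr => i _; case: ltnP => // le_pi.
by rewrite nth_default // scale0r.
Qed.

Lemma pevD phi p q v : pev phi (p + q) v = pev phi p v + pev phi q v.
Proof.
pose n := maxn (size p) (size q).
rewrite (@pev_widen _ (p + q) _ n) ?size_polyD //.
rewrite (@pev_widen _ p _ n) ?leq_maxl // (@pev_widen _ q _ n) ?leq_maxr //.
by rewrite -big_split; apply: eq_bigr => i _; rewrite coefD scalerDl.
Qed.

Lemma pev0 phi v : pev phi 0 v = 0.
Proof. by rewrite /pev size_poly0 big_ord0. Qed.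

Lemma pevC phi c v : pev phi c%:P v = c *: v.
Proof.
by rewrite (@pev_widen _ _ _ 1) ?size_polyC ?leq_b1 // big_ord1 coefC.
Qed.

Lemma pevMX phi p v : pev phi (p * 'X) v = pev phi p (phi v).
Proof.
have := size_polyMleq p 'X; rewrite size_polyX addn2 /= => le_s.
rewrite (@pev_widen _ _ _ (size p).+1) // big_ord_recl coefMX /= scale0r add0r.
by apply: eq_bigr => i _; rewrite coefMX /= -iterS iterSr.
Qed.

Lemma pev_phi phi p v : pev phi p (phi v) = phi (pev phi p v).
Proof.
rewrite linear_sum; apply: eq_bigr => i _.
by rewrite linearZ -iterSr.
Qed.

Lemma pevM phi p q v : pev phi (p * q) v = pev phi p (pev phi q v).
Proof.
elim/poly_ind: p v => [|p c IHp] v; first by rewrite mul0r !pev0.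
rewrite mulrDl !pevD -mulrA ['X * q]mulrC mulrA !pevMX IHp pev_phi.
congr (_ + _); rewrite !pevC mul_polyC.
rewrite (@pev_widen _ _ _ (size q)) ?size_scale_leq // /pev scaler_sumr.
by apply: eq_bigr => i _; rewrite coefZ scalerA.
Qed.

Lemma pev_comm phi p q v : pev phi p (pev phi q v) = pev phi q (pev phi p v).
Proof. by rewrite -!pevM mulrC. Qed.

Lemma pevXn phi n v : pev phi 'X^n v = iter n phi v.
Proof.
elim: n v => [|n IHn] v; first by rewrite expr0 pevC scale1r.
by rewrite exprSr pevMX IHn iterSr.
Qed.

Lemma pev_linear phi p : linear (pev phi p).
Proof.
move=> a u v; rewrite /pev scaler_sumr -big_split; apply: eq_bigr => i _.
by rewrite iterZD scalerDr !scalerA mulrC.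
Qed.

Lemma pev_v0 phi p : pev phi p 0 = 0.
Proof. by rewrite /pev big1 // => i _; rewrite iter0 scaler0. Qed.

Lemma finite_potent_annihilated phi n : finite_dim (range (iter n phi)) ->
  exists2 p, p != 0 & forall v, pev phi p v = 0.
Proof.
move=> [s Es]; pose d := size s.
have s_in (i : 'I_d) : exists c : 'I_d -> k, phi s`_i = \sum_j c j *: s`_j.
  have : lspan s s`_i.
    exists (fun j => (j == i)%:R); rewrite (bigD1 i) //= eqxx scale1r.
    by rewrite big1 ?addr0 // => j /negPf ->; rewrite scale0r.
  rewrite -Es => -[x _ xE].
  have : range (iter n phi) (phi s`_i) by exists (phi x); rewrite // -iterSr /= xE.
  by rewrite Es.
have [c cE] := choice s_in.
pose L (x : 'rV[k]_d) : V := \sum_i x 0 i *: s`_i.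
suff [q q0 qL]: exists2 q, q != 0 & forall x, pev phi q (L x) = 0.
  exists (q * 'X^n); first by rewrite mulf_neq0 // monic_neq0 ?monicXn.
  move=> v; rewrite pevM pevXn.
  have [c' ->] : lspan s (iter n phi v) by rewrite -Es; exists v.
  rewrite -[RHS](qL (\row_i c' i)); congr (pev _ _ _).
  by apply: eq_bigr => i _; rewrite mxE.
pose A : 'M[k]_d := \matrix_(i, j) c i j.
have LE x : phi (L x) = L (x *m A).
  rewrite linear_sum /L.
  under eq_bigr => i _ do rewrite linearZ /= cE scaler_sumr.
  rewrite exchange_big; apply: eq_bigr => j _; rewrite mxE scaler_suml.
  by apply: eq_bigr => i _; rewrite mxE scalerA.
have LD x y : L (x + y) = L x + L y.
  by rewrite /L -big_split; apply: eq_bigr => i _; rewrite mxE scalerDl.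
have LZ a x : L (a *: x) = a *: L x.
  by rewrite /L scaler_sumr; apply: eq_bigr => i _; rewrite mxE scalerA.
have L0 : L 0 = 0 by rewrite -(scale0r 0) LZ scale0r.
exists (char_poly A); first by rewrite monic_neq0 ?char_poly_monic.
move: (A) (L) LE LD LZ L0; clear; case: d => [|d] A L LE LD LZ L0 x.
  by rewrite (thinmx0 x) L0 pev_v0.
suff -> q : pev phi q (L x) = L (x *m horner_mx A q).
  by rewrite Cayley_Hamilton mulmx0.
elim/poly_ind: q x => [|p a IHp] x; first by rewrite pev0 rmorph0 mulmx0.
rewrite pevD pevMX pevC LE IHp -LZ -LD rmorphD /= mulrC rmorphM /= horner_mx_X.
by rewrite horner_mx_C mulmxDr mul_mx_scalar mulmxA.
Qed.

Lemma pev_iter phi p n v : pev phi p (iter n phi v) = iter n phi (pev phi p v).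
Proof. by rewrite -!pevXn pev_comm. Qed.

Lemma finite_dim_iterD phi n m : finite_dim (range (iter n phi)) ->
  finite_dim (range (iter (m + n) phi)).
Proof.
move=> [s Es]; exists [seq iter m phi x | x <- s]; apply/seteqP.
have iter_comb (c : nat -> k) :
    iter m phi (\sum_(i < size s) c i *: s`_i)
    = \sum_(i < size [seq iter m phi x | x <- s])
        c i *: [seq iter m phi x | x <- s]`_i.
  rewrite size_map iter_sum; apply: eq_bigr => i _.
  by rewrite iterZ (nth_map 0).
have ext d (c : 'I_d -> k) : exists c' : nat -> k, forall i : 'I_d, c i = c' i.
  exists (fun j => oapp c 0 (insub j)) => i.
  by rewrite valK.
split=> v.
  move=> [x _ <-]; rewrite ssrnat.iterD.
  have [c ->] : lspan s (iter n phi x) by rewrite -Es; exists x.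
  have [c' cE] := ext _ c; exists (fun i => c' i); rewrite -iter_comb.
  by congr (iter _ _ _); apply: eq_bigr => i _; rewrite cE.
move=> [c ->]; have [c' cE] := ext _ c.
under eq_bigr => i _ do rewrite cE.
rewrite -iter_comb.
have : lspan s (\sum_(i < size s) c' i *: s`_i) by exists (fun i => c' i).
by rewrite -Es => -[x _ <-]; exists x; rewrite // ssrnat.iterD.
Qed.

Lemma is_AST_exists phi : finite_potent phi -> exists D, is_AST phi D.
Proof.
move=> [n n0 fdn]; have [p p0 pK] := finite_potent_annihilated fdn.
have [N [g]] := multiplicity_XsubC p 0; rewrite p0 subr0 /= => g0 pE.
pose M := (N + n)%N.
have gK v : pev phi g (iter M phi v) = 0.
  by rewrite ssrnat.iterD -pevXn -pevM -pE pK.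
have /Bezout_eq1_coprimepP [[u w] /= uwE] : coprimep g 'X^M.
  by rewrite coprimep_expr // -['X]subr0 coprimep_XsubC.
have decomp v : v = iter M phi (pev phi w v) + pev phi u (pev phi g v).
  rewrite -pev_iter -pevXn -!pevM -pevD addrC uwE.
  by rewrite pevC scale1r.
pose W := range (iter M phi); pose U := [set v | iter M phi v = 0].
have WE x : W x -> x = iter M phi (pev phi w x).
  by move=> [v _ <-]; rewrite {1}[LHS]decomp gK pev_v0 addr0.
have WU0 x : W x -> U x -> x = 0.
  by move=> /WE {2}-> Ux; rewrite -pev_iter Ux pev_v0.
have Wlin a x y : W x -> W y -> W (a *: x + y).
  move=> [v _ <-] [v' _ <-]; exists (a *: v + v') => //; exact: iterZD.
have phiM v : phi (iter M phi v) = iter M phi (phi v) by rewrite -iterS iterSr.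
exists (W, U); split=> /=.
- split; first by rewrite inE; exists 0; rewrite ?iter0.
  by move=> a x y; rewrite !inE; apply: Wlin.
- split; first by rewrite inE /U /= iter0.
  by move=> a x y; rewrite !inE /U /= iterZD => -> ->; rewrite scaler0 addr0.
- split.
    move=> v; exists (iter M phi (pev phi w v)); first by exists (pev phi w v).
    exists (pev phi u (pev phi g v)); last exact: decomp.
    by rewrite /U /= -!pev_iter gK pev_v0.
  apply/seteqP; split=> [x [Wx Ux]|x ->]; first exact: WU0.
  by split; [exists 0; rewrite ?iter0|rewrite /U /= iter0].
- exact: finite_dim_iterD.
- split.
  + by move=> _ [v _ <-]; exists (phi v).
  + move=> x y; rewrite !inE => Wx Wy xyE; apply/eqP; rewrite -subr_eq0; apply/eqP.
    apply: WU0; first by rewrite addrC -scaleN1r; apply: Wlin.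
    rewrite /U /= -(subnK (_ : 0 < M)%N) ?addn_gt0 ?n0 ?orbT // addn1 iterSr.
    by rewrite linearB /= xyE subrr iter0.
  + move=> x Wx; have [v _ vE] := Wx.
    exists (iter M phi (iter M.-1 phi (pev phi w v))); first by eexists.
    rewrite phiM -iterS prednK ?addn_gt0 ?n0 ?orbT // -pev_iter vE.
    by rewrite -WE.
- by move=> _ [v Uv <-]; rewrite /U /= -phiM Uv linear0.
- by exists M.
Qed.

Lemma is_AST_unique phi D D' : is_AST phi D -> is_AST phi D' -> D = D'.
Proof.
have stab E : is_AST phi E -> forall n,
    (forall w, E.1 w -> E.1 (iter n phi w)) /\
    (forall w, E.1 w -> exists2 w', E.1 w' & w = iter n phi w') /\
    (forall w, E.1 w -> iter n phi w = 0 -> w = 0).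
  move=> [[]]; rewrite inE => W0 _ _ _ _ [Wst Winj Wsurj] _ _ n.
  elim: n => [|n [IH1 [IH2 IH3]]]; first by split=> //; split=> // w; exists w.
  split; first by move=> w Ww; rewrite iterS; apply: Wst; apply: IH1.
  split.
    move=> w /Wsurj [w1 /IH2 [w2 Ww2 ->] <-]; exists w2; by [|rewrite iterS].
  move=> w Ww wE; apply: IH3 => //; apply: Winj; rewrite ?inE //; first exact: IH1.
  by rewrite linear0.
have sub E E' : is_AST phi E -> is_AST phi E' ->
    E.1 `<=` E'.1 /\ E.2 `<=` E'.2.
  move=> aE aE'.
  have [_ _ _ _ _ _ [m mU]] := aE.
  have [_ U'lin [dec' _] _ _ _ [m' mU']] := aE'.
  have [/= _ [WE _]] := stab _ aE m'.
  have [/= _ [_ W'inj]] := stab _ aE' m.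
  have [/= W'st _] := stab _ aE' m'.
  split=> [w /WE [w1 _ ->]|u Uu].
    have [w' W'w' [u' U'u' ->]] := dec' w1.
    by rewrite iterD (mU' u') // addr0; apply: W'st.
  have [w' W'w' [u' U'u' uE]] := dec' u.
  have [_ [_ W'inj2]] := stab _ aE' (m + m')%N.
  suff w0 : w' = 0 by rewrite uE w0 add0r.
  apply: W'inj2 => //.
  have : iter (m + m') phi u = 0 by rewrite addnC ssrnat.iterD mU // iter0.
  by rewrite uE iterD (ssrnat.iterD _ _ _ u') (mU' u') // iter0 addr0.
move=> aD aD'; have [s1 s2] := sub _ _ aD aD'; have [s1' s2'] := sub _ _ aD' aD.
by rewrite [D]surjective_pairing [D']surjective_pairing; congr (_, _);
  apply/seteqP; split.
Qed.

Lemma ASTP phi : finite_potent phi -> is_AST phi (AST phi).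
Proof. by move=> /is_AST_exists [D aD]; apply: (xgetPex _ (ex_intro _ D aD)). Qed.

Lemma fp_indexP phi : finite_potent phi ->
  is_nilpotency_order phi (AST_U phi) (fp_index phi).
Proof.
move=> /ASTP [_ _ _ _ _ _ [m mU]]; apply: xgetPex.
have ex : exists n, `[< forall u, AST_U phi u -> iter n phi u = 0 >].
  by exists m; apply/asboolP.
case: (ex_minnP ex) => n /asboolP nU n_min; exists n; split=> // j jU.
by apply: n_min; apply/asboolP.
Qed.

End WellDefined.

(* Main.v *)
(* If [chi], [chi'] witness [phi <=GD1 psi], then [phi = psi chi phi =
   phi chi' psi], so [phi theta phi = phi] for every {1}-inverse [theta] of
   [psi].  Conversely, [psi] has a finite potent {1}-inverse [theta], and its
   rank one perturbations force [phi = phi theta psi = psi theta phi].  If [G]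
   is the inverse of [phi] on [W_phi] plus the compression of [theta] to
   [U_phi], then [G] is a G-Drazin inverse of [phi] with [psi G phi = phi],
   because [phi] and [psi] agree on [W_phi]; hence [chi = G phi theta] is a GD1
   inverse of [phi] with [phi chi = psi chi] and [chi phi = chi psi]. *)
From HB Require Import structures.
Require Import Defs.
From mathcomp Require Import all_boot all_algebra.
From mathcomp Require Import boolp classical_sets functions.

Set Implicit Arguments.
Unset Strict Implicit.
Unset Printing Implicit Defensive.

Import GRing.Theory.
Local Open Scope classical_set_scope.
Local Open Scope ring_scope.

(** * Subspaces and finite-dimensional spans *)

Definition subspace (k : fieldType) (E : lmodType k) (A : set E) : Prop :=
  A 0 /\ forall a u v, A u -> A v -> A (a *: u + v).

Section Subspaces.
Variables (k : fieldType) (E : lmodType k).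
Implicit Types (A : set E) (s t : seq E).

Lemma subspaceZ A a u : subspace A -> A u -> A (a *: u).
Proof. by move=> [A0 AD] Au; rewrite -[_ *: _]addr0; apply: AD. Qed.

Lemma subspaceD A u v : subspace A -> A u -> A v -> A (u + v).
Proof. by move=> [_ AD] Au Av; rewrite -[u]scale1r; apply: AD. Qed.

Lemma subspaceB A u v : subspace A -> A u -> A v -> A (u - v).
Proof. by move=> [_ AD] Au Av; rewrite addrC -scaleN1r; apply: AD. Qed.

Lemma subspace_submod A : submod_closed [in A] -> subspace A.
Proof.
move=> [A0 AD]; split; first by rewrite inE in A0.
by move=> a u v Au Av; move: (AD a u v); rewrite !inE; apply.
Qed.

Lemma subspace0 : subspace [set 0 : E].
Proof. by split=> // a u v -> ->; rewrite /= scaler0 addr0. Qed.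

Lemma lspan_nil : lspan [::] = [set 0 : E].
Proof.
apply/seteqP; split=> [v [c ->]|v ->]; first by rewrite /= big_ord0.
by exists (fun=> 0); rewrite big_ord0.
Qed.

Lemma lspan_cons x s v :
  lspan (x :: s) v <-> exists a, exists2 u, lspan s u & v = a *: x + u.
Proof.
split=> [[c ->]|[a [_ [c ->] ->]]].
  exists (c ord0), (\sum_(i < size s) c (lift ord0 i) *: s`_i).
    by exists (fun i => c (lift ord0 i)).
  by rewrite big_ord_recl.
exists (fun i => oapp c a (unlift ord0 i)).
rewrite big_ord_recl /= unlift_none; congr (_ + _).
by apply: eq_bigr => i _; rewrite liftK.
Qed.

Lemma subspace_lspan s : subspace (lspan s).
Proof.
elim: s => [|x s [IH0 IHD]]; first by rewrite lspan_nil; exact: subspace0.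
split; first by apply/lspan_cons; exists 0, 0; rewrite // scale0r addr0.
move=> a u v /lspan_cons[b [u' su ->]] /lspan_cons[c [v' sv ->]].
apply/lspan_cons; exists (a * b + c), (a *: u' + v'); first exact: IHD.
by rewrite scalerDr scalerDl scalerA addrACA.
Qed.

Lemma lspan_cat s t u v : lspan s u -> lspan t v -> lspan (s ++ t) (u + v).
Proof.
elim: s u => [|x s IH] u; first by rewrite lspan_nil => -> /=; rewrite add0r.
move=> /lspan_cons[a [w sw ->]] tv; apply/lspan_cons.
by exists a, (w + v); rewrite ?addrA //; apply: IH.
Qed.

(** Induction on [s]: a spanning list of the part of [A] inside [lspan s] is enlarged by one vector
    of [A] outside [lspan s], if there is one. *)
Lemma finite_dim_sub A s : subspace A -> A `<=` lspan s -> finite_dim A.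
Proof.
elim: s A => [|x s IH] A sA As.
  exists [::]; apply/seteqP; split=> // v; rewrite lspan_nil => ->; exact: sA.1.
have [|t tE] := IH (A `&` lspan s) _ (@subIsetr _ _ _).
  have [s0 sD] := subspace_lspan s; split; first by split; [exact: sA.1|].
  by move=> a u v [Au su] [Av sv]; split; [apply: sA.2|apply: sD].
have [AI|nA] := pselect (A `<=` lspan s).
  by exists t; rewrite -tE; apply/seteqP; split=> // v Av; split=> //; apply: AI.
have [y [Ay ny]] : exists y, A y /\ ~ lspan s y.
  by apply: contrapT => nex; apply: nA => v Av; apply: contrapT => nv;
     apply: nex; exists v.
have /lspan_cons[a [u su yE]] := As _ Ay.
have a0 : a != 0.
  by apply: contra_notN ny => /eqP a0; rewrite yE a0 scale0r add0r.
exists (y :: t); apply/seteqP; split=> v; last first.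
  move=> /lspan_cons[b [w]]; rewrite -tE => -[Aw _] ->; exact: sA.2.
move=> Av; have /lspan_cons[b [w sw vE]] := As _ Av.
(* The coefficient [b / a] cancels the [x] components of [v] and [y]. *)
apply/lspan_cons; exists (b / a), (v - (b / a) *: y); last by rewrite addrC subrK.
rewrite -tE; split; first by apply: subspaceB => //; exact: subspaceZ.
rewrite vE yE scalerDr scalerA divfK // opprD addrACA subrr add0r.
by apply: subspaceB => //; [|apply: subspaceZ => //]; exact: subspace_lspan.
Qed.

End Subspaces.

(** * Images under linear maps and extension from subspaces *)

Section LinearMaps.
Variables (k : fieldType) (E F : lmodType k).

Lemma linear_packed (f : E -> F) : linear f ->
  exists g : {linear E -> F}, g =1 f.
Proof.
move=> lf; pose m := GRing.isLinear.Build k E F *:%R f lf.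
by pose g : {linear E -> F} := HB.pack f m; exists g.
Qed.

Lemma subspace_image (f : {linear E -> F}) (A : set E) :
  subspace A -> subspace (f @` A).
Proof.
move=> [A0 AD]; split; first by exists 0; rewrite ?linear0.
by move=> a _ _ [u Au <-] [v Av <-]; exists (a *: u + v);
  rewrite ?linearP //; apply: AD.
Qed.

Lemma lspan_map (f : {linear E -> F}) s v :
  lspan s v -> lspan [seq f x | x <- s] (f v).
Proof.
elim: s v => [|x s IH] v; first by rewrite !lspan_nil => ->; rewrite /= linear0.
move=> /lspan_cons[a [u su ->]]; apply/lspan_cons.
by exists a, (f u); rewrite ?linearP //; apply: IH.
Qed.

Lemma finite_dim_image (f : {linear E -> F}) (A : set E) :
  finite_dim A -> finite_dim (f @` A).
Proof.
move=> [s ->]; apply: (@finite_dim_sub _ _ _ [seq f x | x <- s]).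
  by apply: subspace_image; exact: subspace_lspan.
by move=> _ [v sv <-]; apply: lspan_map.
Qed.

(* Zorn's lemma yields a maximal single-valued subspace between [G] and [R];
   by maximality it is the graph of a map defined on all of [E]. *)
Lemma linear_selection (G R : set (E * F)) :
    subspace G -> subspace R -> G `<=` R -> (forall y, G (0, y) -> y = 0) ->
    (forall x, exists y, R (x, y)) ->
  exists f : {linear E -> F},
    (forall x y, G (x, y) -> f x = y) /\ forall x, R (x, f x).
Proof.
move=> sG sR GR Gfun Rtot.
pose good (X : set (E * F)) :=
  [/\ subspace X, G `<=` X, X `<=` R & forall y, X (0, y) -> y = 0].
have goodG : good G by split.
pose P (X : set (E * F)) := X = set0 \/ good X.
have [C CP Ctot|X [PX Xmax]] := @Zorn_bigcup _ P.
  have [[X0 CX0 X0n]|nex] := pselect (exists2 X, C X & X <> set0); last first.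
    left; apply: bigcup0 => X CX; apply: contrapT => Xn.
    by apply: nex; exists X.
  right; have good0 Y y : C Y -> Y y -> good Y.
    by move=> /CP[->|].
  have gX0 : good X0 by case: (CP _ CX0).
  have [sX0 GX0 _ _] := gX0.
  split.
  - split; first by exists X0 => //; exact: sX0.1.
    move=> a u v [Y CY Yu] [Z CZ Zv].
    have [sY _ _ _] := good0 _ _ CY Yu; have [sZ _ _ _] := good0 _ _ CZ Zv.
    by case: (Ctot _ _ CY CZ) => YZ; [exists Z|exists Y] => //;
      [apply: sZ.2|apply: sY.2] => //; apply: YZ.
  - by move=> z Gz; exists X0 => //; apply: GX0.
  - by move=> z [Y CY Yz]; have [_ _ + _] := good0 _ _ CY Yz; apply.
  - by move=> y [Y CY Yy]; have [_ _ _] := good0 _ _ CY Yy; apply.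
have gX : good X.
  case: PX => // X0; exfalso; apply: (Xmax G); last by right.
  split; first by rewrite X0.
  by rewrite X0 => /(_ 0 sG.1).
have [sX GX XR Xfun] := gX.
have Xtot x : exists y, X (x, y).
  apply: contrapT => nx; have [y Rxy] := Rtot x.
  pose Y := [set z | exists a, exists2 u, X u & z = a *: (x, y) + u].
  have XY : X `<=` Y by move=> z Xz; exists 0, z; rewrite // scale0r add0r.
  apply: (Xmax Y).
    split=> // /(_ (x, y)) YX; apply: nx; exists y; apply: YX.
    by exists 1, 0; [exact: sX.1|rewrite scale1r addr0].
  right; split.
  - split; first exact: XY sX.1.
    move=> a _ _ [b [u Xu ->]] [c [v Xv ->]].
    exists (a * b + c), (a *: u + v); first exact: sX.2.
    by rewrite scalerDr scalerDl scalerA addrACA.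
  - by move=> z /GX /XY.
  - by move=> _ [a [u Xu ->]]; apply: sR.2 => //; apply: XR.
  - move=> w [a [[u1 u2] Xu [xE wE]]]; have [a0|a0] := eqVneq a 0.
      apply: Xfun; move: Xu; rewrite wE.
      by move: xE; rewrite a0 !scale0r !add0r => ->.
    (* Here [u1 = - (a *: x)], so scaling by [- a^-1] would give a pair of [X] over [x]. *)
    exfalso; apply: nx; exists (- (a^-1 *: u2)).
    have -> : (x, - (a^-1 *: u2)) = (- a^-1) *: (u1, u2).
      congr pair; last by rewrite scaleNr.
      by rewrite (_ : u1 = - (a *: x)) ?scaleNr ?scalerN ?opprK ?scalerA
        ?mulVf ?scale1r //; apply/eqP; rewrite -addr_eq0 addrC -xE.
    exact: subspaceZ.
have [f fX] := choice Xtot.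
have Xu x y : X (x, y) -> f x = y.
  move=> Xxy; apply/eqP; rewrite -subr_eq0; apply/eqP; apply: Xfun.
  have := subspaceB sX (fX x) Xxy.
  by congr (X _); congr pair; rewrite /= subrr.
have [g gf] : exists g : {linear E -> F}, g =1 f.
  apply: linear_packed => a u v; apply: Xu.
  exact: (sX.2 a (u, f u) (v, f v)).
exists g; split=> [x y /GX Xxy|x]; rewrite gf; [exact: Xu|exact/XR/fX].
Qed.

End LinearMaps.

(** * Finite potent {1}-inverses and their perturbations *)

Section Endomorphisms.
Variables (k : fieldType) (V : lmodType k).
Implicit Types (A B : set V) (phi psi theta : {linear V -> V}).

(** The projection of [A + B] onto [A] along [B] is extended to [V] inside the relation [A z.2],
    which keeps all values in [A]. *)
Lemma projection_exists A B : subspace A -> subspace B ->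
    (forall x, A x -> B x -> x = 0) ->
  exists p : {linear V -> V}, [/\ forall x, A x -> p x = x,
    forall x, B x -> p x = 0 & forall x, A (p x)].
Proof.
move=> sA sB AB0.
pose G := [set z : V * V | exists2 a, A a & exists2 b, B b & z = (a + b, a)].
have [||z [a Aa [b Bb ->]]|y [a Aa [b Bb [abE ->]]]|x|p [pG pA]] :=
  @linear_selection _ _ _ G [set z | A z.2].
- split; first by exists 0; [exact: sA.1|exists 0; rewrite ?addr0 //; exact: sB.1].
  move=> c _ _ [a Aa [b Bb ->]] [a' Aa' [b' Bb' ->]].
  exists (c *: a + a'); first exact: sA.2.
  exists (c *: b + b'); first exact: sB.2.
  by rewrite addrACA -scalerDr.
- split; first exact: sA.1.
  by move=> c u v /= Au Av; apply: sA.2.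
- exact: Aa.
- apply: AB0 => //.
  have -> : a = (-1) *: b by apply/eqP; rewrite scaleN1r -addr_eq0 -abE.
  exact: subspaceZ.
- by exists 0; exact: sA.1.
- exists p; split=> // x Xx; apply: pG.
    by exists x => //; exists 0; rewrite ?addr0 //; exact: sB.1.
  by exists 0; [exact: sA.1|exists x; rewrite ?add0r].
Qed.

(** With [p] a projection onto [psi @] A[, the equation]psi z.2 = p
    z.1[is solvable in]A[over every vector, and]p[is the identity on]psi @[A]. *)
Lemma section_exists A psi : subspace A ->
  exists s : {linear V -> V},
    (forall x, A x -> psi (s (psi x)) = psi x) /\ forall x, A (s x).
Proof.
move=> sA.
have [|p [pA _ Ap]] := projection_exists (subspace_image psi sA) (subspace0 V) => //.
have [||z ->|y [->]//|x|s [_ sR]] := @linear_selection _ _ _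
  [set 0 : V * V] [set z | A z.2 /\ psi z.2 = p z.1].
- exact: subspace0.
- split; first by split; [exact: sA.1|rewrite !linear0].
  move=> a u v [Au uE] [Av vE]; split; first exact: sA.2.
  by rewrite /= !linearP /= uE vE.
- by split; [exact: sA.1|rewrite !linear0].
- by have [y Ay yE] := Ap x; exists y.
exists s; split=> x; last by have [] := sR x.
by move=> Ax; have [_ /= ->] := sR (psi x); apply: pA; exists x.
Qed.

Lemma subspace_iter_image phi n A : subspace A -> subspace (iter n phi @` A).
Proof.
move=> sA; have [f fE] := iterN_linear phi n.
by rewrite (_ : iter n phi = f) ?funeqE //; apply: subspace_image.
Qed.

Lemma finite_dim_subset A B : subspace A -> finite_dim B -> A `<=` B ->
  finite_dim A.
Proof. by move=> sA [s ->]; apply: finite_dim_sub. Qed.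

(* Induction along [A], [psi A], [psi^2 A], ...: a reflexive inverse [T'] of
   [psi] on [psi A] is corrected by a section [s] of [psi] on [ker T'], and
   extended by 0 on a complement of [psi A] containing the image of that
   correction.  Modulo this complement the new [T] is [T'], so it is again
   finite potent. *)
Lemma reflexive_inverse_exists psi n A : subspace A -> psi @` A `<=` A ->
    finite_dim (iter n psi @` A) ->
  exists (T : {linear V -> V}) m,
    [/\ forall x, A (T x), forall x, A x -> psi (T (psi x)) = psi x,
        forall x, A x -> T (psi (T x)) = T x & finite_dim (iter m T @` A)].
Proof.
elim: n A => [|n IH] A sA psiA fdA.
  have [s [sK As]] := section_exists psi sA.
  have [|p [pA _ Ap]] := projection_exists (subspace_image psi sA) (subspace0 V) => //.
  have psK x : psi (s (p x)) = p x by have [y Ay <-] := Ap x; apply: sK.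
  exists (s \o p), 0; split=> //= x Ax; last by rewrite psK (pA _ (Ap x)).
  by rewrite pA ?sK //; exists x.
have sA' := subspace_image psi sA.
have [x [y A'y <-]||T' [m [A'T' psiT' T'psi fdT']]] := IH _ sA'.
- by exists y; [exact: psiA|].
- by move: fdA; rewrite image_comp (_ : iter n psi \o psi = iter n.+1 psi) //;
    apply/funext => x; rewrite iterSr.
have [s [sK As]] := section_exists psi sA.
have sA'K y : (psi @` A) y -> psi (s y) = y by move=> [x Ax <-]; apply: sK.
pose c := (idfun \- (psi \o T') : {linear V -> V}).
have cA' y : (psi @` A) y -> (psi @` A) (c y).
  by move=> A'y; apply: subspaceB => //; exists (T' y) => //; apply: psiA.
have [x A'x [_ [y A'y <-] xE]|p [pA' pS A'p]] :=
  projection_exists sA' (subspace_image s (subspace_image c sA')).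
  (* A common vector [x = s (c y)] satisfies [psi x = psi T' psi x = psi (T' (c y)) = 0]. *)
  have psix : psi x = c y by rewrite -xE sA'K //; apply: cA'.
  suff psix0 : psi x = 0 by rewrite -xE -psix psix0 linear0.
  rewrite -(psiT' x A'x) psix /c /= linearB /= T'psi // subrr linear0.
  by [].
pose T0 := (T' \+ (s \o c) : {linear V -> V}).
have psiT0 y : (psi @` A) y -> psi (T0 y) = y.
  by move=> A'y; rewrite /T0 /= linearD sA'K; [rewrite addrC subrK|exact: cA'].
have pT0 y : (psi @` A) y -> p (T0 y) = T' y.
  move=> A'y; rewrite /T0 /= linearD (pA' _ (A'T' y)) pS ?addr0 //.
  by exists (c y) => //; exists y.
exists (T0 \o p), m.+1; split=> [x|x Ax|x Ax|] /=.
- apply: subspaceD => //; first by apply: psiA; apply: A'T'.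
- by rewrite pA' ?psiT0 //; exists x.
- by rewrite psiT0 // pA'.
(* Since [p] intertwines [T0 \o p] with [T'], one more application of [T0 \o p] lands in the image
   of [iter m T'] under [T0]. *)
have pT x : p (iter m (T0 \o p) x) = iter m T' (p x).
  by elim: m {fdT'} => //= m IHm; rewrite pT0 // IHm.
apply: (@finite_dim_subset _ (T0 @` (iter m T' @` (psi @` A)))).
- exact: (subspace_iter_image (T0 \o p)).
- exact: finite_dim_image.
move=> _ [x Ax <-]; exists (iter m T' (p x)); last by rewrite -pT.
by exists (p x).
Qed.

Lemma X1fp_nonempty psi : finite_potent psi -> exists theta, X1fp psi theta.
Proof.
move=> [n n0 fdn].
have [//|//|T [m [_ psiT _ fdT]]] := @reflexive_inverse_exists psi n setT _ _ fdn.
exists T; split=> [x|]; first exact: psiT.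
(* The successor secures a positive exponent, as [m] may be 0. *)
by exists m.+1 => //; exact: (finite_dim_iterD 1 fdT).
Qed.

(** The powers [(theta + f)^n] and [theta^n] differ by a finite rank map: the next difference is
    [theta] of the current one plus a value of [f]. *)
Lemma finite_potent_perturb theta (f : {linear V -> V}) t :
    finite_potent theta -> (forall x, lspan t (f x)) ->
  finite_potent (theta \+ f).
Proof.
move=> [n n0 [s fdn]] ft; exists n => //.
have [r rE] : exists r, forall x, lspan r (iter n (theta \+ f) x - iter n theta x).
  elim: {n0 fdn} n => [|n [r rE]].
    by exists [::] => x; rewrite /= subrr lspan_nil.
  exists ([seq theta x | x <- r] ++ t) => x.
  rewrite /= addrAC -linearB; apply: lspan_cat; last exact: ft.
  exact: lspan_map.
apply: (@finite_dim_sub _ _ _ (r ++ s)).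
  exact: (@subspace_iter_image (theta \+ f)).
move=> _ [x _ <-]; rewrite -(subrK (iter n theta x) (iter n _ x)).
by apply: lspan_cat => //; rewrite -fdn; exists x.
Qed.

(** The line through [(x, y)] is a graph because [x != 0]; it is extended with values in the line of
    [y]. *)
Lemma rank1_exists (x y : V) : x != 0 ->
  exists f : {linear V -> V}, f x = y /\ forall z, lspan [:: y] (f z).
Proof.
move=> x0.
have in_span c : lspan [:: y] (c *: y).
  by apply/lspan_cons; exists c, 0; rewrite ?addr0 // lspan_nil.
have [||_ [c ->]|z [c [/esym/eqP]]|z|f [fG fR]] := @linear_selection _ _ _
  [set z | exists c : k, z = (c *: x, c *: y)] [set z | lspan [:: y] z.2].
- split; first by exists 0; rewrite !scale0r.
  move=> a _ _ [c ->] [d ->]; exists (a * c + d).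
  by congr pair; rewrite /= scalerDl scalerA.
- split; first exact: (subspace_lspan _).1.
  by move=> a u v uy vy; apply: (subspace_lspan _).2.
- exact: in_span.
- by rewrite scaler_eq0 (negPf x0) orbF => /eqP-> ->; rewrite scale0r.
- by exists (0 *: y); apply: in_span.
by exists f; split=> //; apply: fG; exists 1; rewrite !scale1r.
Qed.

(* [theta + (1 - theta psi) f] and [theta + f (1 - psi theta)] are again finite
   potent {1}-inverses of [psi] for every rank one [f]. *)
Lemma le_minus_factor phi psi theta : le_minus phi psi -> X1fp psi theta ->
  (forall x, phi (theta (psi x)) = phi x) /\
  (forall x, psi (theta (phi x)) = phi x).
Proof.
move=> le [thX thfp]; have psith x : psi (theta (psi x)) = psi x := thX x.
have phith x : phi (theta (phi x)) = phi x.
  by have [/(_ x)] := le theta (conj thX thfp).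
have [phi0|[v phiv]] : (forall x, phi x = 0) \/ exists v, phi v != 0.
  have [[v vP]|nex] := pselect (exists v, phi v != 0); first by right; exists v.
  by left=> x; apply/eqP; apply/negPn/negP => xP; apply: nex; exists x.
  by split=> x; rewrite !phi0 ?linear0.
split=> x; apply/eqP; rewrite -subr_eq0.
  (* As [f] sends [phi v] to [x], the {1}-inverse identity at [v] reads
     [phi (x - theta (psi x)) = 0]. *)
  have [f [fv frk]] := rank1_exists x phiv.
  pose g := ((idfun \- (theta \o psi)) \o f : {linear V -> V}).
  have [] : X1fp phi (theta \+ g).
    apply: le; split.
      by move=> z; rewrite /= /g /= linearD psith linearB /= psith subrr addr0.
    apply: (finite_potent_perturb (t := [:: x - theta (psi x)])) => // z.
    exact: (lspan_map (idfun \- (theta \o psi)) (frk z)).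
  move=> /(_ v); rewrite /= /g /= fv linearD phith linearB /= => /eqP.
  by rewrite -subr_eq0 addrAC subrr add0r -opprB oppr_eq0.
apply/negPn/negP => z0.
(* As [f] sends the supposedly nonzero defect to [x], the identity at [x] yields [phi x = 0], and
   the defect vanishes. *)
have [f [fz frk]] := rank1_exists x z0.
pose g := (f \o (idfun \- (psi \o theta)) : {linear V -> V}).
have [] : X1fp phi (theta \+ g).
  apply: le; split.
    by move=> z; rewrite /= /g /= psith subrr linear0 addr0 psith.
  exact: (@finite_potent_perturb theta g [:: x] thfp (fun z => frk _)).
move=> /(_ x); rewrite /= linearD phith -[RHS]addr0 => /addrI.
rewrite /g /= -opprB !linearN fz => /eqP; rewrite oppr_eq0 => /eqP phix _.
by move: z0; rewrite phix !linear0 addr0 eqxx.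
Qed.

End Endomorphisms.

(** * The AST decomposition and G-Drazin inverses *)

Section ASTDecomposition.
Variables (k : fieldType) (V : lmodType k).
Implicit Types (phi psi theta G chi : {linear V -> V}).

Lemma fp_index_range phi : finite_potent phi ->
  forall v, AST_W phi (iter (fp_index phi) phi v).
Proof.
move=> fp v; have [_ _ [dec _] _ [stW _ _] _ _] := ASTP fp.
have [w Ww [u Uu ->]] := dec v.
rewrite Defs.iterD (proj1 (fp_indexP fp) u Uu) addr0.
by elim: (fp_index phi) => //= n IHn; apply: stW.
Qed.

Lemma AST_W_iter_surj phi n : finite_potent phi ->
  forall w, AST_W phi w -> exists2 w', AST_W phi w' & iter n phi w' = w.
Proof.
move=> fp; have [_ _ _ _ [_ _ surjW] _ _] := ASTP fp.
elim: n => [|n IHn] w Ww; first by exists w.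
by have [w1 /IHn[w2 Ww2 <-] <-] := surjW w Ww; exists w2.
Qed.

Lemma AST_inj phi x y : finite_potent phi -> AST_W phi x -> AST_W phi y ->
  phi x = phi y -> x = y.
Proof.
move=> fp Wx Wy; have [_ _ _ _ [_ injW _] _ _] := ASTP fp.
by apply: injW; rewrite inE.
Qed.

Lemma AST_W_stable phi w : finite_potent phi -> AST_W phi w ->
  AST_W phi (phi w).
Proof. by move=> fp; have [_ _ _ _ [stW _ _] _ _] := ASTP fp; apply: stW. Qed.

(** Writing [phi w = phi^m x], commutation puts [G (phi w) = phi^m (G x)] in [W_phi], where [phi] is
    injective. *)
Lemma XGD_AST_W phi G : finite_potent phi -> XGD phi G ->
  forall w, AST_W phi w -> G (phi w) = w.
Proof.
move=> fp [phiG Gcomm] w Ww.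
apply: (AST_inj fp _ Ww (phiG w)).
have [x Wx <-] := AST_W_iter_surj (fp_index phi) fp (AST_W_stable fp Ww).
by rewrite [G _]Gcomm; apply: fp_index_range.
Qed.

(** [D] is the Drazin inverse: [D v] is the preimage in [W_phi] of the projection of [v] to [W_phi]
    along [U_phi]. *)
Lemma drazin_exists phi : finite_potent phi ->
  exists D : {linear V -> V},
    [/\ forall v, AST_W phi (D v), forall v, D (phi v) = phi (D v),
        forall w, AST_W phi w -> D (phi w) = w &
        forall v, AST_U phi (v - phi (D v))].
Proof.
move=> fp; have [sW sU [dec WU0] _ [stW injW surjW] stU _] := ASTP fp.
have {}sW := subspace_submod sW; have {}sU := subspace_submod sU.
have WU x : (AST phi).1 x -> (AST phi).2 x -> x = 0.
  by move=> Wx Ux; have : [set 0] x by rewrite -WU0.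
have [//|P [PW PU WP]] := projection_exists sW sU.
have UP v : (AST phi).2 (v - P v).
  have [w Ww [u Uu ->]] := dec v.
  by rewrite linearD PW // PU // addr0 addrC addKr.
have Pphi v : P (phi v) = phi (P v).
  rewrite -{1}(subrK (P v) v) linearD [LHS]linearD PU ?add0r.
    by apply: PW; apply: stW.
  by apply: stU; exists (v - P v).
have [|z ->|y [->]//|x|D [_ DR]] := @linear_selection _ _ _
  [set 0 : V * V] [set z | (AST phi).1 z.2 /\ phi z.2 = P z.1] (subspace0 _).
- split; first by split; [exact: sW.1|rewrite !linear0].
  move=> a u v [Wu uE] [Wv vE]; split; first exact: sW.2.
  by rewrite /= !linearP /= uE vE.
- by split; [exact: sW.1|rewrite !linear0].
- by have [y Wy yE] := surjW _ (WP x); exists y.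
have WD v : (AST phi).1 (D v) by have [] := DR v.
have phiD v : phi (D v) = P v by have [] := DR v.
have Dphi v : D (phi v) = P v.
  by apply: (AST_inj fp (WD _) (WP _)); rewrite phiD Pphi.
exists D; split=> // v; rewrite ?phiD ?Dphi //; last exact: UP.
by move=> Wv; apply: PW.
Qed.

(* On [W_phi] this G-Drazin inverse is the inverse of [phi], on [U_phi] it is
   the compression of [theta]. *)
Lemma XGD_exists phi psi theta : finite_potent phi ->
    (forall w, AST_W phi w -> phi w = psi w) ->
    (forall x, phi (theta (phi x)) = phi x) ->
    (forall x, psi (theta (phi x)) = phi x) ->
  exists2 G, XGD phi G & forall x, psi (G (phi x)) = phi x.
Proof.
move=> fp phipsi phith psith.
have [D [WD Dphi DphiW UD]] := drazin_exists fp.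
(* [Q] is the projection onto [U_phi] along [W_phi]. *)
have [Q QE] : exists Q : {linear V -> V}, forall x, Q x = x - phi (D x).
  by exists (idfun \- (phi \o D)).
have phiQ x : phi (Q x) = Q (phi x) by rewrite !QE linearB Dphi.
have [G GE] : exists G : {linear V -> V}, forall x, G x = D x + Q (theta (Q x)).
  by exists (D \+ (Q \o theta \o Q)).
have DQ x : D (Q x) = 0 by rewrite QE linearB /= DphiW // subrr.
have QQphi x : Q (phi (Q x)) = phi (Q x).
  by rewrite [LHS]QE Dphi DQ !linear0 addr0.
have phiG x : phi (G (phi x)) = phi x.
  rewrite GE linearD -phiQ phiQ phith QQphi -linearD QE -Dphi addrC subrK //.
exists G.
  split=> // x /=; set m := fp_index phi.
  have nilQ y : iter m phi (Q y) = 0 by apply: (proj1 (fp_indexP fp)); rewrite QE.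
  have iterQ y : Q (iter m phi y) = iter m phi (Q y).
    by elim: m {nilQ} => //= n IHn; rewrite -phiQ IHn.
  rewrite !GE iterQ nilQ !linear0 addr0 Defs.iterD nilQ addr0.
  by elim: m {nilQ iterQ} => //= n <-.
move=> x; rewrite GE linearD -phipsi // -phiQ; set y := theta _.
(* [y = theta (phi (Q x))] has no [W_phi] component, because [D (phi y) = D (phi (Q x)) = 0]. *)
have psiQy : psi (Q y) = phi (Q x).
  rewrite QE linearB /= -[psi (phi _)]phipsi; last exact: AST_W_stable.
  by rewrite /y psith -Dphi phith Dphi DQ !linear0 addr0.
by rewrite psiQy -linearD QE -Dphi addrC subrK.
Qed.

End ASTDecomposition.

Theorem theorem4p18 (k : fieldType) (V : lmodType k) (phi psi : {linear V -> V})
    (fp_phi : finite_potent phi) (fp_psi : finite_potent psi) :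
  leGD1 phi psi <->
  (forall w, AST_W phi w -> phi w = psi w) /\ le_minus phi psi.
Proof.
split.
  move=> [chi [chi' [[_ [f [G [fX GX chiphi phichi]]]]
                     [_ [f' [G' [fX' _ chiphi' phichi']]]] phipsi phipsi']]].
  have phichiphi x : phi (chi (phi x)) = phi x.
    by rewrite [LHS]phichi; apply: fX.
  have phichiphi' x : phi (chi' (phi x)) = phi x.
    by rewrite [LHS]phichi'; apply: fX'.
  split=> [w Ww|theta [psith fpth]].
    (* On [W_phi] the map [chi phi = G phi] is the identity, so
       [phi w = psi (chi (phi w)) = psi w]. *)
    rewrite -{1}(phichiphi w) [LHS]phipsi /=.
    by congr (psi _); rewrite [LHS]chiphi; apply: XGD_AST_W.
  split=> // x /=.
  (* Padding with [chi'] and [chi] turns [phi theta phi] into [phi chi' psi theta psi chi phi],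
     where [psi theta psi = psi] applies. *)
  rewrite -{1}(phichiphi x) -{1}(phichiphi' (theta _)).
  rewrite [chi' _]phipsi' /= [phi (chi _)]phipsi /= [psi (theta _)]psith.
  by rewrite -[psi (chi _)]phipsi /= phichiphi phichiphi'.
move=> [phipsi le]; have [theta Xth] := X1fp_nonempty fp_psi.
have [phithpsi psithphi] := le_minus_factor le Xth.
have phith x : phi (theta (phi x)) = phi x := (le _ Xth).1 x.
have [G GX psiG] := XGD_exists fp_phi phipsi phith psithphi.
have phiG x : phi (G (phi x)) = phi x := GX.1 x.
pose chi := (G \o phi \o theta : {linear V -> V}).
have chiX : XGD1 phi chi.
  split; first by move=> x; rewrite /= /chi /= !phith phiG.
  by exists theta, G; split=> // x; rewrite /= /chi /= ?phith ?phiG.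
(* Here [psi chi = phi theta = phi chi] by [psi G phi = phi], and [chi psi = G phi = chi phi] by
   [phi theta psi = phi]. *)
by exists chi, chi; split=> // x; rewrite /= /chi /= ?phiG ?psiG ?phithpsi ?phith.
Qed.
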